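(* Let $\alpha,\beta,\gamma\in\widehat{\kappa^*}$ satisfy $(\alpha+\gamma+\overline{\alpha}\gamma,\varepsilon)=0$, and let $f\colon\widehat{\kappa^*}\to\mathbb{C}$ be any map. For all $x,y\in\kappa$ with $x\ne0,1$, \[ \sum_{\nu,\mu\in\widehat{\kappa^*}}f(\mu)\frac{(\alpha+\gamma)_\nu(\beta\overline{\alpha}+\beta\overline{\gamma})_\mu\,\nu(x)\mu(y)}{(\beta)^\circ_{\mu\nu}(\varepsilon)^\circ_\nu(\varepsilon)^\circ_\mu} =\beta\overline{\alpha\gamma}(1-x)\sum_{\eta\in\widehat{\kappa^*}}\frac{(\beta\overline{\alpha}+\beta\overline{\gamma})_\eta}{(\beta+\varepsilon)^\circ_\eta}\eta(x)\sum_{\mu\in\widehat{\kappa^*}}f(\mu)\frac{(\overline{\eta})_\mu}{(\varepsilon)^\circ_\mu}\mu\!\left(\frac{y(x-1)}{x}\right) \] \[ +(1-q)^2\,\overline{\beta}(-y)\left(f(\alpha\overline{\beta})\frac{(\varepsilon)^\circ_\beta}{(\overline{\gamma})_\beta}\alpha\!\left(-\frac{y}{x}\right)+f(\gamma\overline{\beta})\frac{(\varepsilon)^\circ_\beta}{(\overline{\alpha})_\beta}\gamma\!\left(-\frac{y}{x}\right)\right). \]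
   Context: $\kappa$ is a finite field with $q$ elements; $\widehat{\kappa^*}=\mathrm{Hom}(\kappa^*,\mathbb{C}^* )$, written multiplicatively, characters extended by $\varphi(0)=0$; $\varepsilon$ trivial, $\overline{\varphi}=\varphi^{-1}$ (e.g. $\overline{\alpha\gamma}=(\alpha\gamma)^{-1}$). $\delta(\varphi)=1$ if $\varphi=\varepsilon$, else $0$. Fix a nontrivial additive character $\psi$; $g(\varphi)=-\sum_{x\in\kappa}\varphi(x)\psi(x)$, $g^\circ(\varphi)=q^{\delta(\varphi)}g(\varphi)$, $(\varphi)_\nu=g(\varphi\nu)/g(\varphi)$, $(\varphi)^\circ_\nu=g^\circ(\varphi\nu)/g^\circ(\varphi)$. $P$ is the free abelian monoid on $\widehat{\kappa^*}$ written additively, with symmetric bilinear pairing determined by $(\alpha,\beta)=\delta(\alpha\overline\beta)$ (so $(\alpha+\gamma+\overline\alpha\gamma,\varepsilon)=0$ means $\alpha,\gamma,\overline\alpha\gamma$ are all nontrivial). For $\mathbf a=\alpha_1+\dots+\alpha_r$, $(\mathbf a)_\nu=\prod(\alpha_i)_\nu$, $(\mathbf a)^\circ_\nu=\prod(\alpha_i)^\circ_\nu$. *)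

(* Defs.v *)
From HB Require Import structures.
From mathcomp Require Import all_boot all_order all_fingroup all_algebra.
From mathcomp Require Import cyclic.

Set Implicit Arguments.
Unset Strict Implicit.
Unset Printing Implicit Defensive.

Import GRing.Theory.
Local Open Scope ring_scope.

Section MulChar.
Variables (F : finFieldType) (C : numClosedFieldType).

(* Values in C^* are automatic: chi u * chi u^-1 = chi 1 = 1. *)
Definition is_mchar (chi : {ffun {unit F} -> C}) : bool :=
  (chi 1%g == 1) && [forall u, forall v, chi (u * v)%g == chi u * chi v].

Record mchar := MChar { mchar_val : {ffun {unit F} -> C}; _ : is_mchar mchar_val }.

HB.instance Definition _ := [isSub for mchar_val].
HB.instance Definition _ := [Choice of mchar by <:].

Implicit Types chi phi : mchar.

Lemma mchar_valP chi : is_mchar (mchar_val chi).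
Proof. by case: chi. Qed.

Lemma mchar_val1 chi : mchar_val chi 1%g = 1.
Proof. by have /andP[/eqP] := mchar_valP chi. Qed.

Lemma mchar_valM chi u v :
  mchar_val chi (u * v)%g = mchar_val chi u * mchar_val chi v.
Proof. by have /andP[_ /forallP/(_ u)/forallP/(_ v)/eqP] := mchar_valP chi. Qed.

Lemma mchar_val_neq0 chi u : mchar_val chi u != 0.
Proof.
apply/eqP => chiu0; have := mchar_val1 chi.
by rewrite -(mulgV u) mchar_valM chiu0 mul0r => /esym/eqP; rewrite oner_eq0.
Qed.

Lemma mchar_valX chi u n : mchar_val chi (u ^+ n)%g = mchar_val chi u ^+ n.
Proof.
elim: n => [|n IHn]; first by rewrite expg0 mchar_val1 expr0.
by rewrite expgS exprS mchar_valM IHn.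
Qed.

(* Finiteness: all values are roots of X^n - 1 with n = #|F^*|. *)
Definition mchar_values : seq C :=
  sval (closed_field_poly_normal ('X^#|[set: {unit F}]| - 1 : {poly C})).

Lemma mchar_valuesP chi u : mchar_val chi u \in mchar_values.
Proof.
rewrite /mchar_values; case: closed_field_poly_normal => s /= Ds.
have n_gt0 : (0 < #|[set: {unit F}]|)%N by apply: cardG_gt0.
have lc : lead_coef ('X^#|[set: {unit F}]| - 1 : {poly C}) = 1.
  by rewrite lead_coefXnsubC.
move: Ds; rewrite lc scale1r => Ds.
rewrite -root_prod_XsubC -Ds rootE !hornerE -mchar_valX.
by rewrite expg_cardG ?inE // mchar_val1 subrr.
Qed.

Definition mchar_code chi : {ffun {unit F} -> 'I_(size mchar_values).+1} :=
  [ffun u => inord (index (mchar_val chi u) mchar_values)].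

Definition mchar_decode (c : {ffun {unit F} -> 'I_(size mchar_values).+1}) :
    option mchar :=
  insub [ffun u => nth 0 mchar_values (c u)].

Lemma mchar_codeK : pcancel mchar_code mchar_decode.
Proof.
move=> chi; rewrite /mchar_decode -[RHS]valK; congr (insub _).
apply/ffunP => u; rewrite !ffunE inordK ?ltnS ?index_size //.
by rewrite nth_index ?mchar_valuesP.
Qed.

HB.instance Definition _ := isCountable.Build mchar
  (pcan_pickleK mchar_codeK).
HB.instance Definition _ : isFinite mchar := PCanIsFinite mchar_codeK.

Lemma mchar_one_subproof : is_mchar [ffun => 1].
Proof.
apply/andP; split; first by rewrite ffunE.
by apply/forallP => u; apply/forallP => v; rewrite !ffunE mulr1.
Qed.

Lemma mchar_mul_subproof chi phi :
  is_mchar [ffun u => mchar_val chi u * mchar_val phi u].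
Proof.
apply/andP; split; first by rewrite ffunE !mchar_val1 mulr1.
by apply/forallP => u; apply/forallP => v; rewrite !ffunE !mchar_valM mulrACA.
Qed.

Lemma mchar_inv_subproof chi : is_mchar [ffun u => (mchar_val chi u)^-1].
Proof.
apply/andP; split; first by rewrite ffunE mchar_val1 invr1.
by apply/forallP => u; apply/forallP => v; rewrite !ffunE mchar_valM invfM.
Qed.

Definition mchar_one := MChar mchar_one_subproof.
Definition mchar_mul chi phi := MChar (mchar_mul_subproof chi phi).
Definition mchar_inv chi := MChar (mchar_inv_subproof chi).

Lemma mchar_mulA : associative mchar_mul.
Proof. by move=> a b c; apply/val_inj/ffunP => u; rewrite !ffunE mulrA. Qed.

Lemma mchar_mul1 : left_id mchar_one mchar_mul.
Proof. by move=> a; apply/val_inj/ffunP => u; rewrite !ffunE mul1r. Qed.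

Lemma mchar_mulV : left_inverse mchar_one mchar_inv mchar_mul.
Proof.
by move=> a; apply/val_inj/ffunP => u; rewrite !ffunE mulVf ?mchar_val_neq0.
Qed.

HB.instance Definition _ :=
  Finite_isGroup.Build mchar mchar_mulA mchar_mul1 mchar_mulV.

(* Extension by zero to all of F; in particular the trivial character is also
   0 at 0. *)
Definition mchar_eval chi (x : F) : C :=
  if insub x is Some u then mchar_val chi u else 0.

End MulChar.

Bind Scope group_scope with mchar.
Arguments mchar_val {F C} _%_g.
Arguments mchar_eval {F C} chi%_g x%_R.
Coercion mchar_eval : mchar >-> Funclass.

(* The free abelian monoid on the finite set of characters, a multiset being
   given by its multiplicities. *)
Notation charsum F C := {ffun mchar F C -> nat}.

Section GaussSums.
Variables (F : finFieldType) (C : numClosedFieldType).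
Implicit Types (phi nu : mchar F C) (a b : charsum F C).

Definition delta phi : nat := (phi == 1%g).

Definition gen phi : charsum F C := [ffun chi => (chi == phi) : nat].

Definition pairing a b : nat :=
  (\sum_phi \sum_chi a phi * b chi * delta (phi * chi^-1)%g)%N.

Definition additive_character (psi : F -> C) : Prop :=
  psi 0 = 1 /\ forall x y, psi (x + y) = psi x * psi y.

Definition nontrivial_character (psi : F -> C) : Prop := exists x, psi x <> 1.

Variable psi : F -> C.

Definition gauss phi : C := - \sum_(x : F) phi x * psi x.

Definition gauss_circ phi : C := #|F|%:R ^+ delta phi * gauss phi.

Definition poch a nu : C :=
  \prod_phi (gauss (phi * nu)%g / gauss phi) ^+ a phi.

Definition poch_circ a nu : C :=
  \prod_phi (gauss_circ (phi * nu)%g / gauss_circ phi) ^+ a phi.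

End GaussSums.

Arguments delta {F C} phi%_g.
Arguments gen {F C} phi%_g.
Arguments gauss {F C} psi phi%_g.
Arguments gauss_circ {F C} psi phi%_g.
Arguments poch {F C} psi a%_R nu%_g.
Arguments poch_circ {F C} psi a%_R nu%_g.
Arguments pairing {F C} a%_R b%_R.

(* Main.v *)
(** Compare the coefficients of each [f mu].  On the left it is a finite
    hypergeometric sum [2F1 (alpha, gamma; beta mu; x)]; on the right the sum
    over [eta], reindexed by [eta = mu sigma] and simplified by the reflection
    formula for Gauss sums, becomes
    [2F1 (beta mu / alpha, beta mu / gamma; beta mu; x)].  The theorem is thus
    Euler's transformation of 2F1.  Expanding Gauss sums pairwise and summing
    over characters turns 2F1 into a one-variable Euler integral, on which the
    transformation is a Mobius substitution.  It fails only when [beta mu] is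
    [alpha] or [gamma], where one factor of the integrand acquires a point
    mass; the defect is a Jacobi sum and yields the two extra terms. *)

Require Import Defs.
From HB Require Import structures.
From mathcomp Require Import all_boot all_order all_fingroup all_algebra.
From mathcomp Require Import cyclic separable cyclotomic reals complex ring.

Set Implicit Arguments.
Unset Strict Implicit.
Unset Printing Implicit Defensive.

Import GRing.Theory Num.Theory.
Local Open Scope ring_scope.

(** * Multiplicative characters: evaluation and orthogonality *)

Section Characters.
Variables (F : finFieldType) (C : numClosedFieldType).
Implicit Types (chi phi : mchar F C) (x y : F) (u : {unit F}).

Lemma mchar_unit chi u : chi (val u) = mchar_val chi u.
Proof. by rewrite /mchar_eval valK. Qed.

Lemma mchar0 chi : chi 0 = 0.
Proof. by rewrite /mchar_eval insubF // unitr0. Qed.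

Lemma mchar_ind (P : F -> Prop) :
  P 0 -> (forall u, P (val u)) -> forall x, P x.
Proof.
move=> P0 Pu x; have [->//|xn0] := eqVneq x 0.
have ux : x \is a GRing.unit by rewrite unitfE.
by have := Pu (Sub x ux); rewrite SubK.
Qed.

Lemma mchar1 chi : chi 1 = 1.
Proof. by rewrite -[1]/(val (1%g : {unit F})) mchar_unit mchar_val1. Qed.

Lemma mcharM chi x y : chi (x * y) = chi x * chi y.
Proof.
elim/mchar_ind: x => [|u]; first by rewrite mul0r mchar0 mul0r.
elim/mchar_ind: y => [|v]; first by rewrite mulr0 mchar0 mulr0.
by rewrite -[X in chi X]/(val (u * v)%g) !mchar_unit mchar_valM.
Qed.

Lemma mchar_eq0 chi x : (chi x == 0) = (x == 0).
Proof.
elim/mchar_ind: x => [|u]; first by rewrite mchar0 !eqxx.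
rewrite mchar_unit (negPf (mchar_val_neq0 _ _)).
by have := valP u; rewrite unitfE => /negPf ->.
Qed.

Lemma mchar_neq0 chi x : x != 0 -> chi x != 0.
Proof. by rewrite mchar_eq0. Qed.

Lemma mcharV chi x : chi x^-1 = (chi x)^-1.
Proof.
have [->|x0] := eqVneq x 0; first by rewrite invr0 mchar0 invr0.
apply: (mulIf (mchar_neq0 chi x0)).
by rewrite -mcharM !mulVf ?mchar1 ?mchar_neq0.
Qed.

Lemma mcharN1_sqr chi : chi (-1) * chi (-1) = 1.
Proof. by rewrite -mcharM mulN1r opprK mchar1. Qed.

Lemma mcharN chi x : chi (- x) = chi (-1) * chi x.
Proof. by rewrite -mcharM mulN1r. Qed.

Lemma mchar_mulE chi phi x : (chi * phi)%g x = chi x * phi x.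
Proof.
elim/mchar_ind: x => [|u]; first by rewrite !mchar0 mul0r.
by rewrite !mchar_unit ffunE.
Qed.

Lemma mchar_invE chi x : (chi^-1)%g x = (chi x)^-1.
Proof.
elim/mchar_ind: x => [|u]; first by rewrite !mchar0 invr0.
by rewrite !mchar_unit ffunE.
Qed.

Lemma mchar_oneE x : (1%g : mchar F C) x = (x != 0)%:R.
Proof.
elim/mchar_ind: x => [|u]; first by rewrite mchar0 eqxx.
by rewrite mchar_unit ffunE; have := valP u; rewrite unitfE => ->.
Qed.

Lemma mchar_ext chi phi : chi =1 phi -> chi = phi.
Proof.
by move=> e; apply/val_inj/ffunP => u; rewrite -!mchar_unit.
Qed.

Lemma mchar_mulgC chi phi : (chi * phi = phi * chi)%g.
Proof. by apply: mchar_ext => x; rewrite !mchar_mulE mulrC. Qed.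

Lemma sum_mchar chi :
  \sum_(x : F) chi x = (chi == 1%g)%:R * (#|F|%:R - 1).
Proof.
have [->|nchi] := eqVneq chi 1%g.
  under eq_bigr do rewrite mchar_oneE.
  rewrite mul1r (bigD1 (0 : F)) //= eqxx add0r.
  under eq_bigr => x xn0 do rewrite xn0.
  rewrite -natr_sum sum1_card cardC1; apply/(addIr 1); rewrite subrK natr1.
  by rewrite prednK //; apply/card_gt0P; exists 0.
have [z z0 chiz] : exists2 z : F, z != 0 & chi z != 1.
  apply/exists_inP; apply: contraNT nchi; rewrite negb_exists_in => /forall_inP h.
  apply/eqP/mchar_ext => z; rewrite mchar_oneE.
  have [->|z0] := eqVneq z 0; first by rewrite mchar0.
  by apply/eqP; have := h _ z0; rewrite negbK.
(* Reindexing by [z] multiplies the sum by [chi z], so [1 - chi z], which is nonzero, annihilates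
   it. *)
rewrite mul0r; apply: (mulfI (x := 1 - chi z)); first by rewrite subr_eq0 eq_sym.
rewrite mulr0 mulrBl mul1r mulr_sumr [X in X - _](reindex_inj (mulfI z0)) /=.
by apply/eqP; rewrite subr_eq0; apply/eqP/eq_bigr => x _; rewrite mcharM.
Qed.

(** In characteristic 0 the polynomial ['X^n - 1] is separable, hence has [n] distinct roots in [C];
    that many roots of unity must include a primitive one. *)
Lemma prim_root_exists n : (0 < n)%N -> exists z : C, n.-primitive_root z.
Proof.
move=> n_gt0; have [r Dp] := closed_field_poly_normal ('X^n - 1 : {poly C}).
rewrite (monicP _) ?monicXnsubC // scale1r in Dp.
have rn1 : all n.-unity_root r by apply/allP=> z; rewrite -root_prod_XsubC -Dp.
have sz_r : (n < (size r).+1)%N.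
  by rewrite -(size_prod_XsubC r id) -Dp size_XnsubC.
have [|z] := hasP (has_prim_root n_gt0 rn1 _ sz_r); last by exists z.
by rewrite -separable_prod_XsubC -Dp separable_Xn_sub_1 // pnatr_eq0 -lt0n.
Qed.

(** The unit group is cyclic: sending a generator to a primitive root of unity of the same order
    gives a faithful character, which separates every [x] from 1. *)
Lemma mchar_separates x : x != 0 -> x != 1 -> exists chi, chi x != 1.
Proof.
move=> x0 x1.
have /cyclicP[w Dw] : cyclic [set: {unit F}] := field_unit_group_cyclic _.
have [z prz] := prim_root_exists (order_gt0 w).
have [e De] : exists e : {unit F} -> nat, forall u, u = (w ^+ e u)%g.
  apply: (@fin_all_exists _ (fun=> nat) (fun u i => u = (w ^+ i)%g)) => u.
  by have /cycleP[i ->] : u \in <[w]>%g; [rewrite -Dw inE | exists i].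
(* [e] is a discrete logarithm to base [w]. As [z] and [w] have the same order, [z ^+ e u] depends
   on [u] alone and not on the chosen exponent. *)
have zexp u i : u = (w ^+ i)%g -> z ^+ e u = z ^+ i.
  move=> Du; apply/eqP; rewrite (eq_prim_root_expr prz).
  by rewrite -eq_expg_mod_order -De Du.
have chiP : is_mchar [ffun u => z ^+ e u].
  apply/andP; split; first by rewrite ffunE (zexp _ 0%N) ?expg0.
  apply/forallP => u; apply/forallP => v; rewrite !ffunE.
  by rewrite (zexp _ (e u + e v)%N) ?exprD // expgD -!De.
exists (MChar chiP); have ux : x \is a GRing.unit by rewrite unitfE.
pose u : {unit F} := Sub x ux.
have -> : x = val u by rewrite SubK.
rewrite mchar_unit ffunE -(expr0 z) (eq_prim_root_expr prz).
rewrite -eq_expg_mod_order -De expg0; apply: contraNneq x1 => u1.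
by rewrite -[x]/(val u) u1.
Qed.

Lemma sum_mchar_dual x :
  \sum_(chi : mchar F C) chi x = (x == 1)%:R * (#|F|%:R - 1).
Proof.
have sum_off z : z != 1 -> \sum_(chi : mchar F C) chi z = 0.
  move=> z1; have [->|z0] := eqVneq z 0; first by apply: big1 => *; rewrite mchar0.
  have [phi phiz] := mchar_separates z0 z1.
  apply: (mulfI (x := 1 - phi z)); first by rewrite subr_eq0 eq_sym.
  rewrite mulr0 mulrBl mul1r mulr_sumr [X in X - _](reindex_inj (mulgI phi)) /=.
  apply/eqP; rewrite subr_eq0; apply/eqP/eq_bigr => chi _.
  by rewrite mchar_mulE.
have [->|x1] := eqVneq x 1; last by rewrite mul0r sum_off.
(* The number of characters comes from a double count: over all [z] and [chi], only [z = 1]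
   contributes in one order and only the trivial character in the other. *)
transitivity (\sum_(z : F) \sum_(chi : mchar F C) chi z).
  by rewrite (bigD1 (1 : F)) //= [X in _ + X]big1 ?addr0.
rewrite exchange_big (bigD1 (1%g : mchar F C)) //= sum_mchar eqxx.
by rewrite big1 ?addr0 // => chi nchi; rewrite sum_mchar (negPf nchi) mul0r.
Qed.

End Characters.

(** * Gauss sums and the reflection formula *)

Section GaussSumTheory.
Variables (F : finFieldType) (C : numClosedFieldType) (psi : F -> C).
Hypotheses (psi_add : additive_character psi)
  (psi_nontriv : nontrivial_character psi).
Implicit Types (a b c chi phi nu : mchar F C) (x y : F).
Local Notation q := (#|F|%:R : C).
Local Notation g := (gauss psi).
Local Notation gc := (gauss_circ psi).

Lemma N1_neq0 : (-1 : F) != 0. Proof. by rewrite oppr_eq0 oner_eq0. Qed.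

Lemma mcharN1V phi : (phi (-1))^-1 = phi (-1).
Proof.
apply: (mulfI (mchar_neq0 phi N1_neq0)).
by rewrite mulfV ?mchar_neq0 ?N1_neq0 ?mcharN1_sqr.
Qed.

Lemma card_neq0 : q != 0.
Proof. by rewrite pnatr_eq0 -lt0n; apply/card_gt0P; exists 0. Qed.

Lemma sum_psi x : \sum_(u : F) psi (u * x) = (x == 0)%:R * q.
Proof.
have [psi0 psiD] := psi_add.
have [->|x0] := eqVneq x 0.
  by under eq_bigr do rewrite mulr0 psi0; rewrite sumr_const mul1r.
rewrite mul0r; transitivity (\sum_(u : F) psi u).
  by rewrite [RHS](reindex_inj (mulIf x0)).
have [z /eqP psiz] := psi_nontriv.
apply: (mulfI (x := 1 - psi z)); first by rewrite subr_eq0 eq_sym.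
rewrite mulr0 mulrBl mul1r mulr_sumr [X in X - _](reindex_inj (addrI z)) /=.
apply/eqP; rewrite subr_eq0; apply/eqP/eq_bigr => u _.
by rewrite psiD.
Qed.

(** The Fourier transform of [phi]. It is a multiple of the inverse character when [phi] is
    nontrivial; for trivial [phi] it has a point mass at 0, the source of the degenerate cases
    below. *)
Definition twisted_sum phi x : C := \sum_(u : F) phi u * psi (u * x).

Lemma twisted_sum_one x : twisted_sum 1%g x = (x == 0)%:R * q - 1.
Proof.
rewrite -sum_psi [in RHS](bigD1 0) //= mul0r (proj1 psi_add) addrAC subrr add0r.
rewrite /twisted_sum (bigD1 0) //= mchar0 mul0r add0r.
by apply: eq_bigr => u u0; rewrite mchar_oneE u0 mul1r.
Qed.

Lemma twisted_sumE phi x : phi != 1%g -> twisted_sum phi x = - (phi x)^-1 * g phi.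
Proof.
move=> nphi; rewrite /gauss mulNr mulrN opprK; have [->|x0] := eqVneq x 0.
  rewrite mchar0 invr0 mul0r /twisted_sum.
  under eq_bigr do rewrite mulr0 (proj1 psi_add) mulr1.
  by rewrite sum_mchar (negPf nphi) mul0r.
rewrite mulr_sumr [RHS](reindex_inj (mulIf x0)); apply: eq_bigr => u _.
by rewrite mcharM mulrA mulrCA mulVf ?mchar_neq0 // mulr1.
Qed.

Lemma gauss_one : g 1%g = 1.
Proof.
have := twisted_sum_one 1; rewrite oner_eq0 mul0r sub0r => /(congr1 -%R).
by rewrite opprK => <-; congr (- _); apply: eq_bigr => u _; rewrite mulr1.
Qed.

(** In the double sum over the two Gauss variables, the variable of [phi] is written as [s] times
    the variable [u] of the other; the sum over [u] is then a twisted sum. *)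
Lemma gauss_mulV phi chi :
  g phi * g chi^-1 = \sum_s phi s * twisted_sum (phi * chi^-1) (1 + s).
Proof.
have psiD := proj2 psi_add.
rewrite /gauss mulrNN mulrC mulr_suml.
under [RHS]eq_bigr do rewrite mulr_sumr.
rewrite [RHS]exchange_big; apply: eq_bigr => u _ /=.
have [->|u0] := eqVneq u 0.
  by rewrite !mchar0 !mul0r big1 // => s _; rewrite mul0r mulr0.
rewrite mulr_sumr (reindex_inj (mulIf u0)); apply: eq_bigr => s _ /=.
by rewrite mulrDr mulr1 (mulrC u s) psiD mchar_mulE mcharM; ring.
Qed.

(** With [chi = phi] in [gauss_mulV] the twisted sum belongs to the trivial character, and its point
    mass selects [s = -1]. The factor [q] in [gauss_circ] makes the formula hold for trivial [phi]
    too. *)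
Lemma gauss_reflection phi : g phi * gc phi^-1 = phi (-1) * q.
Proof.
rewrite /gauss_circ /delta; have [->|nphi] := eqVneq phi 1%g.
  by rewrite invg1 eqxx expr1 gauss_one mchar_oneE oppr_eq0 oner_eq0 mulr1.
rewrite invg_eq1 (negPf nphi) expr0 mul1r gauss_mulV mulgV.
under eq_bigr do rewrite twisted_sum_one mulrBr mulr1.
rewrite sumrB sum_mchar (negPf nphi) mul0r subr0.
rewrite (bigD1 (-1)) //= subrr eqxx mul1r big1 ?addr0 // => s sN1.
by rewrite addrC addr_eq0 (negPf sN1) mul0r mulr0.
Qed.

Lemma gauss_neq0 phi : g phi != 0.
Proof.
have := mulf_neq0 (mchar_neq0 phi N1_neq0) card_neq0.
by rewrite -gauss_reflection mulf_eq0 => /norP[].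
Qed.

Lemma gauss_circE phi : gc phi = phi (-1) * q / g phi^-1.
Proof.
apply/(canRL (mulfK (gauss_neq0 _))); rewrite mulrC.
have := gauss_reflection phi^-1%g; rewrite invgK => ->.
by rewrite mchar_invE mcharN1V.
Qed.

Lemma gauss_circ_neq0 phi : gc phi != 0.
Proof. by rewrite mulf_neq0 ?expf_neq0 ?card_neq0 ?gauss_neq0. Qed.

Lemma gaussV phi : g phi^-1 = phi (-1) * q / gc phi.
Proof.
rewrite gauss_circE mulrC invf_div mulfVK //.
by rewrite mulf_neq0 ?card_neq0 ?mchar_neq0 ?N1_neq0.
Qed.

Lemma gauss_circ_one : gc 1%g = q.
Proof. by rewrite /gauss_circ /delta eqxx expr1 gauss_one mulr1. Qed.

Lemma gauss_circ_nontrivial phi : phi != 1%g -> gc phi = g phi.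
Proof. by move=> h; rewrite /gauss_circ /delta (negPf h) expr0 mul1r. Qed.

(* Otherwise [field] unfolds [gauss] down to its leading opposite. *)
Local Opaque gauss gauss_circ.

(** * Finite hypergeometric sums and their Euler integrals *)

Definition hyp2F1 a c b x : C :=
  \sum_(nu : mchar F C) (g (a * nu) / g a * (g (c * nu) / g c))
     / (gc (b * nu) / gc b * (gc nu / gc 1)) * nu x.

Lemma hyp2F1C a c b x : hyp2F1 a c b x = hyp2F1 c a b x.
Proof. by apply: eq_bigr => nu _; rewrite (mulrC (g (a * nu) / _)). Qed.

(** Reflection moves the denominators into the numerator, where the Gauss sums pair up in the shape
    required by [gauss_mulV]; the two signs [nu (-1)] cancel. *)
Lemma hyp2F1_gauss a c b x :
  hyp2F1 a c b x = b (-1) * gc b / (q * g a * g c) *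
    \sum_(nu : mchar F C) g (a * nu) * g (b * nu)^-1 * (g (c * nu) * g nu^-1) * nu x.
Proof.
rewrite mulr_sumr; apply: eq_bigr => nu _.
rewrite (gauss_circE (b * nu)) (gauss_circE nu) gauss_circ_one mchar_mulE.
have b0 := mchar_neq0 b N1_neq0; have nu0 := mchar_neq0 nu N1_neq0.
have g0 := gauss_neq0; have gcb0 := gauss_circ_neq0 b; have q0 := card_neq0.
transitivity ((nu (-1) * nu (-1))^-1 * (b (-1))^-1 * gc b / (q * g a * g c)
  * (g (a * nu) * g (b * nu)^-1 * (g (c * nu) * g nu^-1) * nu x)).
  by field; rewrite !g0 b0 nu0 gcb0 q0.
by rewrite mcharN1_sqr invr1 mul1r mcharN1V.
Qed.

(** Each pair of Gauss sums becomes a sum over [s] or [w]. Orthogonality over [nu] forces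
    [s * w * x = 1], leaving [s] alone, and nontriviality of [c] evaluates the second twisted
    sum. *)
Lemma hyp2F1_integral a c b x : c != 1%g -> x != 0 ->
  hyp2F1 a c b x = - (q - 1) * b (-1) * gc b / (q * g a) *
    \sum_s a s * twisted_sum (a * b^-1) (1 + s) / c (1 + s * x).
Proof.
move=> nc x0.
have -> : - (q - 1) * b (-1) * gc b / (q * g a)
    = b (-1) * gc b / (q * g a * g c) * (- (q - 1) * g c).
  by field; rewrite !gauss_neq0 card_neq0.
rewrite hyp2F1_gauss -[RHS]mulrA; congr (_ * _); rewrite mulr_sumr.
transitivity (\sum_(nu : mchar F C) \sum_s \sum_w a s * twisted_sum (a * b^-1) (1 + s) *
   (c w * twisted_sum c (1 + w)) * nu (s * w * x)).
  apply: eq_bigr => nu _.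
  rewrite gauss_mulV gauss_mulV invMg mulgA mulgK mulgK mulr_suml mulr_suml.
  apply: eq_bigr => s _; rewrite mulr_sumr mulr_suml; apply: eq_bigr => w _.
  by rewrite !mchar_mulE !mcharM; ring.
rewrite exchange_big; apply: eq_bigr => s _ /=; rewrite exchange_big /=.
under eq_bigr do rewrite -mulr_sumr sum_mchar_dual.
have [->|s0] := eqVneq s 0.
  by rewrite mchar0 !mul0r mulr0 big1 // => w _; rewrite !mul0r.
have sx0 : s * x != 0 by rewrite mulf_neq0.
have De w : (s * w * x == 1) = (w == (s * x)^-1).
  by rewrite mulrAC -[RHS](inj_eq (mulfI sx0)) mulfV.
rewrite (bigD1 (s * x)^-1) //= [X in _ + X]big1 ?addr0; last first.
  by move=> w nw; rewrite De (negPf nw) mul0r mulr0.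
rewrite De eqxx mul1r (twisted_sumE _ nc) mcharV.
have -> : 1 + (s * x)^-1 = (1 + s * x) / (s * x) by field; rewrite s0 x0.
rewrite (mcharM c (1 + _)) mcharV invfM invrK.
by have h := mchar_neq0 c sx0; move: (c (1 + s * x))^-1 => B; field.
Qed.

(* The Mobius involution [s |-> - (1 + s) / (1 + s x)] exchanges [0] with [-1]
   and [- 1 / x] with infinity. *)
Lemma integral_mobius a b c x : x != 0 -> x != 1 ->
  \sum_s (b s / a s * a (1 + s) / (b (1 + s * x) / c (1 + s * x)))
  = b (-1) * (a (1 - x) * c (1 - x) / b (1 - x)) *
    \sum_s (a s * (b (1 + s) / a (1 + s)) / c (1 + s * x)).
Proof.
move=> x0 x1.
have x1' : 1 - x != 0 by rewrite subr_eq0 eq_sym.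
pose m s := - (1 + s) / (1 + s * x).
have mE s : 1 + s * x != 0 -> 1 + m s * x = (1 - x) / (1 + s * x).
  by move=> h; rewrite /m; field.
have m1E s : 1 + s * x != 0 -> 1 + m s = - s * (1 - x) / (1 + s * x).
  by move=> h; rewrite /m; field.
have m_neq0 s : 1 + s * x != 0 -> 1 + m s * x != 0.
  by move=> h; rewrite mE // mulf_neq0 ?invr_neq0.
have mK s : 1 + s * x != 0 -> m (m s) = s.
  by move=> h; rewrite {1}/m mE // m1E //; field; rewrite h x1'.
(* At the pole [1 + s * x = 0], division by zero gives [m s = 0] and then [m (m s) = -1]; this
   equals [s] only if [x = 1]. So the pole drops out of the reindexing domain. *)
have dom s : (1 + m s * x != 0) && (m (m s) == s) = (1 + s * x != 0).
  have [h|h] := eqVneq (1 + s * x) 0; last by rewrite m_neq0 // mK // eqxx.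
  have -> : m s = 0 by rewrite /m h invr0 mulr0.
  rewrite mul0r addr0 oner_eq0 /= {1}/m mul0r !addr0 divr1.
  by apply: contraNF x1' => /eqP e; rewrite -h -e mulN1r.
have nz P : (forall s, 1 + s * x = 0 -> P s = 0) ->
    \sum_s P s = \sum_(s | 1 + s * x != 0) P s :> C.
  move=> P0; rewrite [RHS]big_mkcond; apply: eq_bigr => s _.
  by case: eqP => //= /P0.
rewrite nz => [|s ->]; last by rewrite !mchar0 mul0r invr0 mulr0.
rewrite [in RHS]nz => [|s ->]; last by rewrite mchar0 invr0 mulr0.
rewrite (reindex_onto m m) /= => [|s]; last exact: mK.
rewrite mulr_sumr; apply: eq_big => [s|s]; first exact: dom.
rewrite dom => h.
rewrite mE // m1E // /m.
have [->|s1] := eqVneq (1 + s) 0.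
  by rewrite oppr0 mul0r !mchar0 !(mul0r, mulr0).
have [->|s0] := eqVneq s 0.
  by rewrite oppr0 !mul0r !mchar0 !(mul0r, mulr0).
rewrite !mcharM !(mcharN _ (1 + s)) !(mcharN _ s) !mcharV.
have ha := mchar_neq0 a; have hb := mchar_neq0 b; have hc := mchar_neq0 c.
by field; rewrite !(ha, hb, hc) ?N1_neq0.
Qed.

(** * Euler's transformation, generic and degenerate cases *)

(** All characters whose twisted sums occur are nontrivial, so both sides are multiples of integrals
    related by [integral_mobius]; reflection matches the remaining Gauss factors. *)
Lemma hyp2F1_euler_generic a c b x : a != 1%g -> c != 1%g -> b != a -> b != c ->
  x != 0 -> x != 1 ->
  hyp2F1 a c b x = (b * a^-1 * c^-1)%g (1 - x) * hyp2F1 (b * a^-1) (b * c^-1) b x.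
Proof.
move=> na nc nba nbc x0 x1.
have ntriv phi chi : phi != chi -> (phi * chi^-1 != 1)%g.
  by move=> h; rewrite -eq_mulgV1.
rewrite !hyp2F1_integral ?ntriv //.
have -> : (b * a^-1 * b^-1 = a^-1)%g by rewrite mchar_mulgC mulKg.
have nV : (a^-1 != 1)%g by rewrite invg_eq1.
have nab : (a * b^-1 != 1)%g by rewrite ntriv // eq_sym.
pose S := \sum_s (a s * (b (1 + s) / a (1 + s)) / c (1 + s * x)).
have -> : \sum_s a s * twisted_sum (a * b^-1) (1 + s) / c (1 + s * x)
    = - g (a * b^-1) * S.
  rewrite mulr_sumr; apply: eq_bigr => s _.
  by rewrite twisted_sumE // mchar_mulE mchar_invE invfM invrK; ring.
have -> : \sum_s (b * a^-1)%g s * twisted_sum a^-1 (1 + s) / (b * c^-1)%g (1 + s * x)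
    = - g a^-1 * (b (-1) * (a (1 - x) * c (1 - x) / b (1 - x)) * S).
  rewrite -integral_mobius // mulr_sumr; apply: eq_bigr => s _.
  by rewrite twisted_sumE // !(mchar_mulE, mchar_invE) invrK; ring.
have ga0 := gauss_neq0.
have e1 : g (a * b^-1) = a (-1) * b (-1) * q / g (b * a^-1).
  have := gauss_circE (a * b^-1)%g.
  by rewrite gauss_circ_nontrivial // mchar_mulE mchar_invE mcharN1V invMg invgK.
have x1' : 1 - x != 0 by rewrite subr_eq0 eq_sym.
rewrite e1 gaussV (gauss_circ_nontrivial na) !(mchar_mulE, mchar_invE).
have ha := mchar_neq0 a x1'; have hb := mchar_neq0 b x1'.
have hc := mchar_neq0 c x1'.
by field; rewrite !ga0 ha hb hc card_neq0.
Qed.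

(** The Gauss quotient is minus a Jacobi-type sum in [s], and the substitution [h] sending [s] to
    [- s * x / (1 + s * x)] carries that sum to the integral. *)
Lemma gauss_mulV_integral a c x : a != c -> x != 0 ->
  \sum_s (a s / c (1 + s * x))
  = - a (-1) * (a x)^-1 * (g a * g c^-1 / g (a * c^-1)).
Proof.
move=> nac x0.
have nac' : (a * c^-1 != 1)%g by rewrite -eq_mulgV1.
pose S := \sum_s a s * (c (1 + s) / a (1 + s)).
have -> : g a * g c^-1 / g (a * c^-1) = - S.
  apply/(canLR (mulfK (gauss_neq0 _))); rewrite gauss_mulV mulNr mulr_suml -sumrN.
  apply: eq_bigr => s _.
  by rewrite twisted_sumE // mchar_mulE mchar_invE invfM invrK; ring.
rewrite mulrN mulNr mulNr opprK.
have ax0 := mchar_neq0 a x0.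
suff -> : S = a (-1) * a x * \sum_s (a s / c (1 + s * x)).
  by rewrite mulrA mulrACA mcharN1_sqr mulVf // !mul1r.
pose h s := - s * x / (1 + s * x); pose k s := - s / (x * (1 + s)).
have hE s : 1 + s * x != 0 -> 1 + h s = (1 + s * x)^-1.
  by move=> s1; rewrite /h; field.
have hk s : s != -1 -> h (k s) = s.
  rewrite -subr_eq0 opprK addrC => s1.
  have e : 1 + k s * x = (1 + s)^-1 by rewrite /k; field; rewrite x0 s1.
  by rewrite /h e /k invrK; field; rewrite x0 s1.
(* At the pole [h s] defaults to 0 and [k 0 = 0], whereas [s] is nonzero there. *)
have dom s : (h s != -1) && (k (h s) == s) = (1 + s * x != 0).
  have [e|s1] := eqVneq (1 + s * x) 0.
    have -> : h s = 0 by rewrite /h e invr0 mulr0.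
    apply/negbTE; rewrite negb_and; apply/orP; right.
    rewrite /k oppr0 mul0r; apply/eqP => s0.
    by move: e; rewrite -s0 mul0r addr0 => /eqP; rewrite oner_eq0.
  rewrite -subr_eq0 opprK addrC hE // invr_neq0 //= /k hE // /h.
  by apply/eqP; field; rewrite s1 x0.
rewrite /S (bigD1 (-1)) //= subrr !mchar0 mul0r mulr0 add0r.
rewrite (reindex_onto h k hk) (eq_bigl _ _ dom).
rewrite mulr_sumr [LHS]big_mkcond; apply: eq_bigr => s _ /=.
case: eqP => [->|/eqP s1] /=; first by rewrite mchar0 invr0 !mulr0.
rewrite hE // /h !mcharM mcharN !mcharV.
have := mchar_neq0 a s1; have := mchar_neq0 c s1 => c1 a1.
by field; rewrite a1 c1.
Qed.

Definition euler_defect a c x : C :=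
  (1 - q) ^+ 2 * (a^-1)%g x * (g a * g c^-1 / (q * g (a * c^-1))).

(** Both sides are combinations of the integral [S] and of a term from [s = -1]. The latter cancel;
    the weights of [S] differ, and this difference, evaluated by [gauss_mulV_integral], is the
    defect. *)
Lemma hyp2F1_euler_degenerate a c x : a != 1%g -> c != 1%g -> a != c ->
  x != 0 -> x != 1 ->
  hyp2F1 a c a x = (c^-1)%g (1 - x) * hyp2F1 1 (a * c^-1) a x
    + euler_defect a c x.
Proof.
move=> na nc nac x0 x1; rewrite /euler_defect.
have nac' : (a * c^-1 != 1)%g by rewrite -eq_mulgV1.
have nV : (a^-1 != 1)%g by rewrite invg_eq1.
have x1' : 1 - x != 0 by rewrite subr_eq0 eq_sym.
pose S := \sum_s (a s / c (1 + s * x)).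
rewrite !hyp2F1_integral // mulgV mul1g gauss_circ_nontrivial // gauss_one.
have -> : \sum_s a s * twisted_sum 1 (1 + s) / c (1 + s * x)
    = q * a (-1) / c (1 - x) - S.
  under eq_bigr do rewrite twisted_sum_one mulrBr mulr1 mulrBl.
  rewrite sumrB; congr (_ - _); rewrite (bigD1 (-1)) //= subrr eqxx mul1r mulN1r.
  rewrite big1 ?addr0 => [|s sN1]; first by ring.
  by rewrite addrC addr_eq0 (negPf sN1) mul0r mulr0 mul0r.
have -> : \sum_s (1%g : mchar F C) s * twisted_sum a^-1 (1 + s) / (a * c^-1)%g (1 + s * x)
    = - g a^-1 * (a (-1) * c (1 - x) * (S - a (-1) / c (1 - x))).
  transitivity (- g a^-1 *
    \sum_s (a s / a s * a (1 + s) / (a (1 + s * x) / c (1 + s * x)))).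
    rewrite mulr_sumr; apply: eq_bigr => s _.
    rewrite twisted_sumE // -(mulgV a) !(mchar_mulE, mchar_invE) invrK; ring.
  rewrite integral_mobius //.
  (* The quotient [a (1 + s) / a (1 + s)] is 0 rather than 1 at [s = -1], so that term of [S] is
     removed. *)
  have -> : \sum_s a s * (a (1 + s) / a (1 + s)) / c (1 + s * x)
      = S - a (-1) / c (1 - x).
    rewrite /S [in RHS](bigD1 (-1)) //= mulN1r addrAC subrr add0r.
    rewrite (bigD1 (-1)) //= subrr mchar0 !mul0r mulr0 mul0r add0r.
    apply: eq_bigr => s sN1; rewrite mulfV ?mulr1 // mchar_neq0 //.
    by rewrite addrC addr_eq0.
  by rewrite (mulrC (a (1 - x))) mulfK ?mchar_neq0 // mulrA.
have -> : (g a * g c^-1 / (q * g (a * c^-1))) = - a (-1) * a x * S / q.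
  rewrite /S gauss_mulV_integral // -[LHS]mul1r -{1}(mcharN1_sqr a).
  by field; rewrite card_neq0 gauss_neq0 !mchar_neq0.
rewrite !mchar_invE.
have ga0 := gauss_neq0.
rewrite gaussV gauss_circ_nontrivial //.
have := card_neq0; have := mchar_neq0 a x0; have := mchar_neq0 c x1'.
move=> c0 a0 q0.
(* Both sides are arranged so that [a (-1)] enters through its square, which is 1, before [field]
   applies. *)
transitivity (- (q - 1) / q * (q * (a (-1) * a (-1)) / c (1 - x) - S * a (-1))).
  by field; rewrite q0 ga0 c0.
have -> : - (q - 1) * a (-1) * g a / (q * 1) *
   (- (a (-1) * q / g a) * (a (-1) * c (1 - x) * (S - a (-1) / c (1 - x))))
   = (q - 1) * (a (-1) * a (-1)) * c (1 - x)
     * (S * a (-1) - (a (-1) * a (-1)) / c (1 - x)).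
  by field; rewrite q0 ga0 c0.
rewrite mcharN1_sqr; field.
by rewrite q0 a0 c0.
Qed.

Lemma hyp2F1_euler a c b x : a != 1%g -> c != 1%g -> a != c ->
  x != 0 -> x != 1 ->
  hyp2F1 a c b x
  = (b * a^-1 * c^-1)%g (1 - x) * hyp2F1 (b * a^-1) (b * c^-1) b x
    + (b == a)%:R * euler_defect a c x + (b == c)%:R * euler_defect c a x.
Proof.
move=> na nc nac x0 x1.
have [->|nba] := eqVneq b a.
  rewrite (negPf nac) mul0r addr0 mul1r mulgV mul1g.
  exact: hyp2F1_euler_degenerate.
rewrite mul0r addr0; have [->|nbc] := eqVneq b c.
  (* The case [b = c] is the previous one with the upper parameters exchanged. *)
  rewrite mul1r mulgV; have -> : (c * a^-1 * c^-1 = a^-1)%g by rewrite mchar_mulgC mulKg.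
  by rewrite hyp2F1C [X in _ * X + _]hyp2F1C hyp2F1_euler_degenerate // eq_sym.
by rewrite mul0r addr0 hyp2F1_euler_generic.
Qed.

(** * Reduction of the double sum to 2F1, coefficient by coefficient *)

Definition poch2_ratio a c b (mu : mchar F C) : C :=
  g (a * mu) / g a * (g (c * mu) / g c) / (gc (b * mu) / gc b * (gc mu / gc 1)).

(* Substitute [eta = mu sigma] and use reflection to turn [(eta^-1)_mu / (1)_eta]
   into [mu (-1) / (1)_sigma]. *)
Lemma sum_eta_hyp2F1 a c b (mu : mchar F C) x :
  \sum_(eta : mchar F C)
     poch2_ratio a c b eta * eta x * (g (eta^-1 * mu) / g eta^-1)
  = mu (- x) * (gc mu / gc 1 * poch2_ratio a c b mu)
     * hyp2F1 (a * mu) (c * mu) (b * mu) x.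
Proof.
rewrite (reindex_inj (mulgI mu)) mulr_sumr; apply: eq_bigr => s _.
have Vmu : ((mu * s)^-1 * mu = s^-1)%g by rewrite invMg mulgKV.
rewrite Vmu /poch2_ratio !mulgA.
rewrite !gaussV !mchar_mulE mcharN.
have n0 phi : phi (-1) != 0 := mchar_neq0 phi N1_neq0.
have g0 := gauss_neq0; have gc0 := gauss_circ_neq0; have q0 := card_neq0.
have -> : s (-1) * q / gc s / (mu (-1) * s (-1) * q / gc (mu * s)%g)
  = mu (-1) * gc (mu * s)%g / gc s.
  by rewrite -{2}(mcharN1V mu); field; rewrite !gc0 !n0 q0.
rewrite gauss_circ_one.
by field; rewrite !g0 !gc0 q0.
Qed.

(** This is the contribution of the index [a * b^-1] to the extra terms. [g (a * c^-1)] cancels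
    between weight and defect, and reflection removes [g (b * a^-1)] against [gc (a * b^-1)]. *)
Lemma euler_defect_coef a b c y x : a != 1%g -> a != c -> x != 0 ->
  (a * b^-1)%g y * poch2_ratio (b * a^-1) (b * c^-1) b (a * b^-1)
    * euler_defect a c x
  = (1 - q) ^+ 2 * (b^-1)%g (- y)
    * ((gc b / gc 1) / (g (c^-1 * b) / g c^-1) * a (- (y / x))).
Proof.
move=> na nac x0; rewrite /poch2_ratio /euler_defect.
have -> : (b * a^-1 * (a * b^-1) = 1)%g by rewrite mulgA mulgKV mulgV.
have -> : (b * c^-1 * (a * b^-1) = a * c^-1)%g.
  by rewrite (mchar_mulgC b) (mchar_mulgC a) mulgA mulgK mchar_mulgC.
have -> : (b * (a * b^-1) = a)%g by rewrite mchar_mulgC mulgKV.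
rewrite (mchar_mulgC c^-1) (gauss_circ_nontrivial na) gauss_circ_one gauss_one.
have -> : gc (a * b^-1) = (a (-1))^-1 * (b (-1))^-1 * q / g (b * a^-1).
  by rewrite gauss_circE mchar_mulE mchar_invE mcharN1V invMg invgK mcharN1V.
rewrite !(mchar_mulE, mchar_invE) (mcharN _ y) (mcharN _ (y / x)) mcharM mcharV.
rewrite (invfM (b (-1)) (b y)) {2}(mcharN1V b).
have g0 := gauss_neq0; have gc0 := gauss_circ_neq0; have q0 := card_neq0.
have n0 phi : phi (-1) != 0 := mchar_neq0 phi N1_neq0.
have a0 := mchar_neq0 a x0; move: (b y)^-1 => B.
by field; rewrite !g0 !gc0 q0 !n0 a0.
Qed.

Lemma prod_gen (h : mchar F C -> C) a : \prod_phi h phi ^+ gen a phi = h a.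
Proof.
rewrite (bigD1 a) //= ffunE eqxx expr1 big1 ?mulr1 // => phi nphi.
by rewrite ffunE (negPf nphi) expr0.
Qed.

Lemma prod_gen_add (h : mchar F C -> C) a c :
  \prod_phi h phi ^+ (gen a + gen c)%R phi = h a * h c.
Proof.
rewrite -(prod_gen h a) -(prod_gen h c) -big_split; apply: eq_bigr => phi _.
have -> : (gen a + gen c)%R phi = (gen a phi + gen c phi)%N by rewrite [LHS]ffunE.
exact: exprD.
Qed.

Lemma appell_reduction a b c (f : mchar F C -> C) x y :
  a != 1%g -> c != 1%g -> a != c -> x != 0 -> x != 1 ->
  \sum_(nu : mchar F C) \sum_(mu : mchar F C)
     f mu * (poch psi (gen a + gen c) nu
             * poch psi (gen (b * a^-1) + gen (b * c^-1)) mu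
             * nu x * mu y)
          / (poch_circ psi (gen b) (mu * nu)
             * poch_circ psi (gen 1) nu * poch_circ psi (gen 1) mu)
  = (b * (a * c)^-1)%g (1 - x)
    * (\sum_(eta : mchar F C)
         poch psi (gen (b * a^-1) + gen (b * c^-1)) eta
         / poch_circ psi (gen b + gen 1) eta
         * eta x
         * \sum_(mu : mchar F C)
              f mu * (poch psi (gen eta^-1) mu / poch_circ psi (gen 1) mu)
                   * mu (y * (x - 1) / x))
    + (1 - q) ^+ 2 * (b^-1)%g (- y)
      * (f (a * b^-1)%g
           * (poch_circ psi (gen 1) b / poch psi (gen c^-1) b)
           * a (- (y / x))
         + f (c * b^-1)%g
           * (poch_circ psi (gen 1) b / poch psi (gen a^-1) b)
           * c (- (y / x))).
Proof.
move=> na nc nac x0 x1.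
have g0 := gauss_neq0; have gc0 := gauss_circ_neq0.
pose w mu := poch2_ratio (b * a^-1) (b * c^-1) b mu.
have pochE d nu : poch psi (gen d) nu = g (d * nu) / g d by exact: prod_gen.
have pochDE d e nu : poch psi (gen d + gen e) nu
    = g (d * nu) / g d * (g (e * nu) / g e) by exact: prod_gen_add.
have circE d nu : poch_circ psi (gen d) nu = gc (d * nu) / gc d by exact: prod_gen.
have circDE d e nu : poch_circ psi (gen d + gen e) nu
    = gc (d * nu) / gc d * (gc (e * nu) / gc e) by exact: prod_gen_add.
(* The circled symbol of [b] at [mu * nu] is that of [b] at [mu] times that of [b * mu] at [nu]. The
   first factor goes into [w mu]; the second makes [b * mu] the lower parameter. *)
transitivity (\sum_(mu : mchar F C) f mu * (mu y * w mu * hyp2F1 a c (b * mu) x)).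
  rewrite exchange_big; apply: eq_bigr => mu _ /=; rewrite !mulr_sumr.
  apply: eq_bigr => nu _; rewrite !pochDE !circE !mul1g mulgA /w /poch2_ratio.
  by field; rewrite !g0 !gc0.
have -> : \sum_(eta : mchar F C)
         poch psi (gen (b * a^-1) + gen (b * c^-1)) eta
         / poch_circ psi (gen b + gen 1) eta * eta x
         * \sum_(mu : mchar F C)
              f mu * (poch psi (gen eta^-1) mu / poch_circ psi (gen 1) mu)
                   * mu (y * (x - 1) / x)
  = \sum_(mu : mchar F C) f mu * (mu y * mu (1 - x) * w mu
      * hyp2F1 (b * a^-1 * mu) (b * c^-1 * mu) (b * mu) x).
  under eq_bigr do rewrite mulr_sumr.
  rewrite exchange_big; apply: eq_bigr => mu _ /=.
  (* The factor [mu (- x)] is the one produced by [sum_eta_hyp2F1]. *)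
  have -> : mu y * mu (1 - x) = mu (y * (x - 1) / x) * mu (- x).
    by rewrite -!mcharM; congr (mchar_eval mu _); field.
  transitivity (f mu * mu (y * (x - 1) / x) / (gc mu / gc 1)
    * \sum_(eta : mchar F C) poch2_ratio (b * a^-1) (b * c^-1) b eta * eta x
        * (g (eta^-1 * mu) / g eta^-1)).
    rewrite mulr_sumr; apply: eq_bigr => eta _.
    rewrite pochDE pochE circDE circE !mul1g /poch2_ratio.
    by field; rewrite !g0 !gc0.
  by rewrite sum_eta_hyp2F1 -/(w mu); field; rewrite !gc0.
rewrite mulr_sumr.
under eq_bigr => mu _ do rewrite (hyp2F1_euler _ na nc nac x0 x1).
(* A defect occurs for just one [mu], namely [d * b^-1] with [d] equal to [a] or [c]. *)
have sum_pick d : \sum_(mu : mchar F C) f mu * (mu y * w mu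
    * ((b * mu == d)%g%:R)) = f (d * b^-1)%g * ((d * b^-1)%g y * w (d * b^-1)%g).
  have De mu : (b * mu == d)%g = (mu == d * b^-1)%g.
    by rewrite (mchar_mulgC d) -(inj_eq (mulgI b) mu) mulKVg.
  rewrite (bigD1 (d * b^-1)%g) //= De eqxx mulr1 big1 ?addr0 // => mu nmu.
  by rewrite De (negPf nmu) !mulr0.
have -> : \sum_(mu : mchar F C) f mu * (mu y * w mu *
    ((b * mu * a^-1 * c^-1)%g (1 - x)
       * hyp2F1 (b * mu * a^-1) (b * mu * c^-1) (b * mu) x
     + (b * mu == a)%g%:R * euler_defect a c x
     + (b * mu == c)%g%:R * euler_defect c a x))
  = \sum_(mu : mchar F C) (b * (a * c)^-1)%g (1 - x) * (f mu *
      (mu y * mu (1 - x) * w mu *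
         hyp2F1 (b * a^-1 * mu) (b * c^-1 * mu) (b * mu) x))
    + (\sum_(mu : mchar F C) f mu * (mu y * w mu * ((b * mu == a)%g%:R)))
        * euler_defect a c x
    + (\sum_(mu : mchar F C) f mu * (mu y * w mu * ((b * mu == c)%g%:R)))
        * euler_defect c a x.
  rewrite !mulr_suml -!big_split /=; apply: eq_bigr => mu _.
  rewrite -!(mulgA b mu) !(mchar_mulgC mu) !mulgA.
  rewrite !mchar_mulE !mchar_invE !mchar_mulE !invfM; ring.
rewrite -addrA; congr (_ + _); rewrite !sum_pick mulrDr; congr (_ + _).
  rewrite -mulrA euler_defect_coef // circE pochE !mul1g; ring.
have -> : w (c * b^-1)%g = poch2_ratio (b * c^-1) (b * a^-1) b (c * b^-1).
  by rewrite /w /poch2_ratio; congr (_ / _); rewrite mulrC.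
rewrite -mulrA euler_defect_coef //; last by rewrite eq_sym.
rewrite circE pochE !mul1g; ring.
Qed.

End GaussSumTheory.

Unset Implicit Arguments.

Theorem theorem3p10 (R : realType) (F : finFieldType)
    (psi : F -> R[i])
    (psi_add : additive_character psi) (psi_nontriv : nontrivial_character psi)
    (alpha beta gamma : mchar F R[i])
    (hyp : pairing (gen alpha + gen gamma + gen (alpha^-1 * gamma)) (gen 1) = 0%N)
    (f : mchar F R[i] -> R[i])
    (x y : F) (x_neq0 : x <> 0) (x_neq1 : x <> 1) :
  \sum_(nu : mchar F R[i]) \sum_(mu : mchar F R[i])
     f mu * (poch psi (gen alpha + gen gamma) nu
             * poch psi (gen (beta * alpha^-1) + gen (beta * gamma^-1)) mu
             * nu x * mu y)
          / (poch_circ psi (gen beta) (mu * nu)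
             * poch_circ psi (gen 1) nu * poch_circ psi (gen 1) mu)
  = (beta * (alpha * gamma)^-1)%g (1 - x)
    * (\sum_(eta : mchar F R[i])
         poch psi (gen (beta * alpha^-1) + gen (beta * gamma^-1)) eta
         / poch_circ psi (gen beta + gen 1) eta
         * eta x
         * \sum_(mu : mchar F R[i])
              f mu * (poch psi (gen eta^-1) mu / poch_circ psi (gen 1) mu)
                   * mu (y * (x - 1) / x))
    + (1 - #|F|%:R) ^+ 2 * (beta^-1)%g (- y)
      * (f (alpha * beta^-1)%g
           * (poch_circ psi (gen 1) beta / poch psi (gen gamma^-1) beta)
           * alpha (- (y / x))
         + f (gamma * beta^-1)%g
           * (poch_circ psi (gen 1) beta / poch psi (gen alpha^-1) beta)
           * gamma (- (y / x))).
Proof.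
have /eqP := hyp; rewrite /pairing sum_nat_eq0 => /forall_inP hyp0.
(* A vanishing sum of naturals has only zero terms; the term pairing [chi] with the trivial
   character is the multiplicity of [chi] when [chi] is trivial. *)
have ntriv (chi : mchar F R[i]) :
    (0 < (gen alpha + gen gamma + gen (alpha^-1 * gamma))%R chi)%N ->
    chi != 1%g.
  move=> gt0; have := hyp0 chi isT; rewrite sum_nat_eq0 => /forall_inP/(_ 1%g isT).
  by rewrite invg1 mulg1 !muln_eq0 eqn0Ngt gt0 ffunE eqxx /delta; case: (chi == 1%g).
(* The third summand of the pairing hypothesis encodes that [alpha] and [gamma] are distinct. *)
have nac : (alpha^-1 * gamma != 1)%g.
  by apply: ntriv; rewrite !ffunE eqxx !natrDE !addn_gt0 orbT.
apply: appell_reduction => //; try exact/eqP.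
- by apply: ntriv; rewrite !ffunE eqxx.
- by apply: ntriv; rewrite !ffunE eqxx !natrDE !addn_gt0 orbT.
- by apply: contraNneq nac => ->; rewrite mulVg.
Qed.
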